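(* Consider the multigrid setting described in the context, with $L+1$ levels, cycle index $\gamma\ge 1$ (an integer), and coarsest-level approximation $\hat{A}_{0}$ of $A_0$ ($\hat A_0$ SPD and $\hat A_0-A_0$ symmetric positive semidefinite). Let $$\sigma_{L}:=\max_{1\leq k\leq L}\sigma_{\rm TG}^{(k)},\qquad \varepsilon_{L}:=\min_{1\leq k\leq L}\lambda_{\min}(\widetilde{M}_{k}^{-1}A_{k}),$$ and assume $0<\sigma_{L}<1-\varepsilon_{L}$. Let $x_{\gamma}$ be the (unique) root of $$(1-\sigma_{L}-\varepsilon_{L})x^{\gamma}-x+\sigma_{L}=0\qquad(0<x<1)$$ contained in $\left(\sigma_{L},\frac{\sigma_{L}}{\sigma_{L}+\varepsilon_{L}}\right]$. If all eigenvalues of $\hat{A}_{0}^{-1}A_{0}$ lie in $$\left[\frac{1-\varepsilon_{L}-x_{\gamma}}{1-\varepsilon_{L}-\sigma_{L}},\,1\right],$$ then $$\sigma_{\rm IMG}^{(k)}\leq x_{\gamma}\qquad\text{for all } k=1,\ldots,L.$$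
   Context: SPD means symmetric positive definite. All matrices are real; $I$ is the identity of appropriate size; $M^{-T}=(M^{-1})^T$; $\lambda_{\min}(\cdot)$ is the smallest eigenvalue. For an SPD matrix $A$, $\|\mathbf{v}\|_A=\langle A\mathbf{v},\mathbf{v}\rangle^{1/2}$ and $\|B\|_A=\max_{\mathbf{v}\ne0}\|B\mathbf{v}\|_A/\|\mathbf{v}\|_A$. Multigrid setting: levels are indexed $0,\ldots,L$ ($L\ge1$; $0$ coarsest, $L$ finest), with $n_{L}>n_{L-1}>\cdots>n_{0}$ unknowns. $A_{L}=A\in\mathbb{R}^{n_L\times n_L}$ is SPD. For $k=1,\ldots,L$, $P_{k}\in\mathbb{R}^{n_{k}\times n_{k-1}}$ has rank $n_{k-1}$, and $A_{k-1}:=P_{k}^{T}A_{k}P_{k}$. $\hat{A}_{0}\in\mathbb{R}^{n_0\times n_0}$ is SPD with $\hat{A}_{0}-A_{0}$ symmetric positive semidefinite. For $k=1,\ldots,L$, $M_{k}\in\mathbb{R}^{n_{k}\times n_{k}}$ is nonsingular with $M_{k}+M_{k}^{T}-A_{k}$ SPD, and $$\widetilde{M}_{k}:=M_{k}^{T}(M_{k}+M_{k}^{T}-A_{k})^{-1}M_{k}.$$ The cycle index $\gamma$ is a positive integer ($\gamma=1$: V-cycle, $\gamma=2$: W-cycle). The exact two-grid iteration matrix at level $k$ is $$E_{\rm TG}^{(k)}=(I-M_{k}^{-T}A_{k})(I-P_{k}A_{k-1}^{-1}P_{k}^{T}A_{k})(I-M_{k}^{-1}A_{k}),\qquad k=1,\ldots,L.$$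 The (inexact) multigrid iteration matrices (one presmoothing step with $M_k$, one postsmoothing step with $M_k^T$, $\gamma$ recursive iterations with zero initial guess for the coarse correction, and $\hat A_0^{-1}$ used on the coarsest level) are $$E_{\rm IMG}^{(1)}=(I-M_{1}^{-T}A_{1})(I-P_{1}\hat{A}_{0}^{-1}P_{1}^{T}A_{1})(I-M_{1}^{-1}A_{1}),$$ $$E_{\rm IMG}^{(k)}=(I-M_{k}^{-T}A_{k})\Big[I-P_{k}\Big(I-\big(E_{\rm IMG}^{(k-1)}\big)^{\gamma}\Big)A_{k-1}^{-1}P_{k}^{T}A_{k}\Big](I-M_{k}^{-1}A_{k}),\qquad k=2,\ldots,L.$$ The convergence factors are $\sigma_{\rm TG}^{(k)}:=\|E_{\rm TG}^{(k)}\|_{A_{k}}$ and $\sigma_{\rm IMG}^{(k)}:=\|E_{\rm IMG}^{(k)}\|_{A_{k}}$. *)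

(* Defs.v *)
From HB Require Import structures.
From mathcomp Require Import all_boot all_order all_algebra.
From mathcomp Require Import classical_sets reals.

Set Implicit Arguments.
Unset Strict Implicit.
Unset Printing Implicit Defensive.

Import Order.TTheory GRing.Theory Num.Theory.

Local Open Scope classical_set_scope.
Local Open Scope ring_scope.

Section MatrixNotions.
Variable R : realType.

Definition quadform m (A : 'M[R]_m) (v : 'cV[R]_m) : R :=
  ((A *m v)^T *m v) ord0 ord0.

Definition spd m (A : 'M[R]_m) : Prop :=
  A^T = A /\ forall v : 'cV[R]_m, v != 0 -> 0 < quadform A v.

Definition spsd m (A : 'M[R]_m) : Prop :=
  A^T = A /\ forall v : 'cV[R]_m, 0 <= quadform A v.

Definition energy_norm m (A : 'M[R]_m) (v : 'cV[R]_m) : R :=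
  Num.sqrt (quadform A v).

(* For A SPD and m > 0 the supremum is attained (the unit sphere of the energy
   norm is compact), so it is the maximum. *)
Definition op_norm m (A B : 'M[R]_m) : R :=
  sup [set energy_norm A (B *m v) / energy_norm A v | v in [set v | v != 0]].

(* Smallest real eigenvalue: a matrix has finitely many eigenvalues, so the
   infimum is a minimum as soon as a real eigenvalue exists. It is only used on
   products S^-1 *m A with S and A SPD, m > 0, all of whose complex eigenvalues
   are real. *)
Definition lambda_min m (B : 'M[R]_m) : R := inf [set a | eigenvalue B a].

End MatrixNotions.

(* Families are indexed by the level k; only the values for k <= L are
   constrained. P k is the prolongation from level k.-1 to level k, and P 0 and
   M 0 are never used. *)
Section Multigrid.
Variables (R : realType) (n : nat -> nat).
Variables (A : forall k, 'M[R]_(n k)) (P : forall k, 'M[R]_(n k, n k.-1)).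
Variables (M : forall k, 'M[R]_(n k)) (hatA0 : 'M[R]_(n 0%N)).
Variable gamma : nat.

Definition Mtilde k : 'M[R]_(n k) :=
  (M k)^T *m invmx (M k + (M k)^T - A k) *m M k.

Definition presmooth k : 'M[R]_(n k) := 1%:M - invmx (M k) *m A k.

Definition postsmooth k : 'M[R]_(n k) := 1%:M - (invmx (M k))^T *m A k.

Definition E_TG k : 'M[R]_(n k) :=
  postsmooth k
  *m (1%:M - P k *m invmx (A k.-1) *m (P k)^T *m A k)
  *m presmooth k.

(* Approximate inverse of A i used for the coarse correction from level i.+1,
   where E is the multigrid iteration matrix of level i: gamma cycles with zero
   initial guess if i > 0, and the coarsest-level solver (E is ignored) if
   i = 0. *)
Definition coarse_solve i : 'M[R]_(n i) -> 'M[R]_(n i) :=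
  match i return 'M[R]_(n i) -> 'M[R]_(n i) with
  | 0 => fun _ => invmx hatA0
  | j.+1 => fun E => (1%:M - E ^+ gamma) *m invmx (A j.+1)
  end.

(* There is no multigrid iteration matrix on level 0; the value there is a
   dummy. *)
Fixpoint E_IMG (k : nat) : 'M[R]_(n k) :=
  match k return 'M[R]_(n k) with
  | 0 => 0
  | i.+1 =>
      postsmooth i.+1
      *m (1%:M - P i.+1 *m coarse_solve (E_IMG i) *m (P i.+1)^T *m A i.+1)
      *m presmooth i.+1
  end.

Definition sigma_TG k : R := op_norm (A k) (E_TG k).

Definition sigma_IMG k : R := op_norm (A k) (E_IMG k).

(* For 1 <= L the neutral elements below are themselves terms of the
   families, so these are the plain maximum and minimum over 1 <= k <= L. *)
Definition sigma_max (L : nat) : R :=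
  \big[Num.max/sigma_TG 1%N]_(1 <= k < L.+1) sigma_TG k.

Definition eps_min (L : nat) : R :=
  \big[Num.min/lambda_min (invmx (Mtilde 1%N) *m A 1%N)]_(1 <= k < L.+1)
    lambda_min (invmx (Mtilde k) *m A k).

End Multigrid.

(* Main.v *)
Require Import Defs.
From HB Require Import structures.
From mathcomp Require Import all_boot all_order all_algebra.
From mathcomp Require Import classical_sets reals.
From mathcomp Require Import ring lra zify.

Set Implicit Arguments.
Unset Strict Implicit.
Unset Printing Implicit Defensive.

Import Order.TTheory GRing.Theory Num.Theory.
Local Open Scope ring_scope.

(** Every iteration matrix [E] of the cycle is symmetric and nonnegative for the
    energy inner product of its level, so that its convergence factor is at most
    [x] as soon as <AEv, v> <= x <Av, v> for all [v] ([energy_bounded]).  The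
    theorem propagates this quadratic form inequality from the coarsest level
    upwards.

    Let [T] be the presmoother, [u = T v], and let [w] be the coarse vector such
    that [P w] is the energy projection of [u] onto the range of [P].  The
    postsmoother is the energy adjoint of [T], so for a coarse solver [S]

      <A E v, v> = <Au, u> - <S Ac w, Ac w>.

    If (1 - d) <Ac w, w> <= <S Ac w, Ac w> <= <Ac w, w>, the right-hand side is
    nonnegative and at most

      (1 - d) (<Au, u> - <Ac w, w>) + d <Au, u>,

    where the first bracket is the form of the exact two-grid matrix, at most
    [sigma <Av, v>], and the last term is at most [d (1 - eps) <Av, v>].
    Hence [E] satisfies the form inequality with the constant
    (1 - d) sigma + d (1 - eps) ([cycle_energy_bounded]).  For d = x ^ gamma
    this constant equals [x] exactly when [x] solves the scalar equation.

    The assumption on [S] holds with d = x ^ gamma on every level: [gamma] cycles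
    bounded by [x] leave an error bounded by x ^ gamma ([energy_bounded_exp],
    [energy_bounded_coarse]), and on the coarsest level the prescribed lower bound
    for the eigenvalues is 1 - x ^ gamma ([coarsest_bounds]).

    The passage from eigenvalues to quadratic forms rests on the extremal case of
    the spectral theorem, [eigenvalue_rayleigh]: the infimum of a Rayleigh
    quotient is an eigenvalue.  It makes [eps] positive and yields the smoother
    bound <ATv, Tv> <= (1 - eps) <Av, v> ([smoother_contraction]).

    For the scalar equation, dividing [x ^+ gamma - 1] by [x - 1] turns it into
    (1 - x) (1 - c (1 + x + ... + x ^ (gamma - 1))) = eps with
    c = 1 - sigma - eps.  The left-hand side decreases strictly while both
    factors are positive, which gives uniqueness; existence is the intermediate
    value theorem between [sigma] and 1. *)

(** * Quadratic forms *)

Section Forms.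
Variable R : realType.

Definition bform m (G : 'M[R]_m) (u v : 'cV[R]_m) : R :=
  (u^T *m G *m v) ord0 ord0.

Lemma bform_tr m (G : 'M[R]_m) u v : bform G^T u v = bform G v u.
Proof.
rewrite /bform -[in RHS](trmxK (v^T *m G *m u)) [in RHS]mxE.
by rewrite !trmx_mul trmxK mulmxA.
Qed.

Lemma quadformE m (G : 'M[R]_m) v : quadform G v = bform G v v.
Proof. by rewrite /quadform trmx_mul -(bform_tr G). Qed.

Lemma bform_mulr m (G B : 'M[R]_m) u v :
  bform G u (B *m v) = bform (G *m B) u v.
Proof. by rewrite /bform !mulmxA. Qed.

Lemma quadform_mul m p (G : 'M[R]_m) (B : 'M[R]_(m, p)) (v : 'cV[R]_p) :
  quadform G (B *m v) = quadform (B^T *m G *m B) v.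
Proof. by rewrite !quadformE /bform trmx_mul !mulmxA. Qed.

Lemma quadformD m (G H : 'M[R]_m) v :
  quadform (G + H) v = quadform G v + quadform H v.
Proof. by rewrite !quadformE /bform mulmxDr mulmxDl mxE. Qed.

Lemma quadformZ m a (G : 'M[R]_m) v : quadform (a *: G) v = a * quadform G v.
Proof. by rewrite !quadformE /bform -scalemxAr -scalemxAl mxE. Qed.

Lemma quadformB m (G H : 'M[R]_m) v :
  quadform (G - H) v = quadform G v - quadform H v.
Proof. by rewrite quadformD -scaleN1r quadformZ mulN1r. Qed.

Lemma quadform0 m (G : 'M[R]_m) : quadform G 0 = 0.
Proof. by rewrite /quadform mulmx0 mxE. Qed.

Lemma quadform_comb m (G : 'M[R]_m) s t u v : G^T = G ->
  quadform G (s *: u + t *: v)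
  = s ^+ 2 * quadform G u + 2 * s * t * bform G u v + t ^+ 2 * quadform G v.
Proof.
move=> sG; rewrite !quadformE.
have -> : bform G (s *: u + t *: v) (s *: u + t *: v)
  = s ^+ 2 * bform G u u + s * t * bform G u v + s * t * bform G v u
    + t ^+ 2 * bform G v v.
  rewrite /bform [(_ + _)^T]linearD /= ![(_ *: _)^T]linearZ /=.
  rewrite !(mulmxDl, mulmxDr) -!(scalemxAl, scalemxAr) !mxE; ring.
by rewrite -(bform_tr G v u) sG; ring.
Qed.

(** For a semidefinite form the usual discriminant argument breaks down when
    [quadform G v = 0], and then expanding the form at one more combination
    of [u] and [v] shows that the cross term vanishes. *)
Lemma psd_CauchySchwarz m (G : 'M[R]_m) u v : spsd G ->
  bform G u v ^+ 2 <= quadform G u * quadform G v.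
Proof.
move=> [sG pG].
have q s t := pG (s *: u + t *: v).
have qu := pG u; have qv := pG v.
have := q (quadform G v) (- bform G u v).
(* For [quadform G v = 0], this combination evaluates to
   - bform G u v ^+ 2 * (quadform G u + 2). *)
have := q (bform G u v) (- (quadform G u + 1)).
rewrite !quadform_comb //.
set a := quadform G u in qu *; set c := quadform G v in qv *.
set b := bform G u v => h1 h2.
have [c0|c0] := eqVneq c 0.
  rewrite c0 mulr0; move: h1; rewrite c0.
  have b2 := sqr_ge0 b.
  nra.
have {}c0 : 0 < c by rewrite lt_def c0.
have h : 0 <= c * (a * c - b ^+ 2) by move: h2; lra.
by move: h; rewrite pmulr_rge0 // subr_ge0.
Qed.

Lemma spd_spsd m (G : 'M[R]_m) : spd G -> spsd G.
Proof.
move=> [sG pG]; split=> // v.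
by have [->|/pG/ltW //] := eqVneq v 0; rewrite quadform0.
Qed.

Lemma spd_unitmx m (G : 'M[R]_m) : spd G -> G \in unitmx.
Proof.
move=> [sG pG]; rewrite unitmxE unitfE; apply/det0P => -[v v0 vG].
have := pG v^T; rewrite -(inj_eq (@trmx_inj _ _ _)) trmxK trmx0.
by move=> /(_ v0); rewrite quadformE /bform trmxK vG mul0mx mxE ltxx.
Qed.

Lemma quadform1_sum m (v : 'cV[R]_m) :
  quadform 1%:M v = \sum_i v i ord0 ^+ 2.
Proof.
rewrite /quadform mul1mx mxE; apply: eq_bigr => i _.
by rewrite mxE expr2.
Qed.

Lemma quadform1_ge0 m (v : 'cV[R]_m) : 0 <= quadform 1%:M v.
Proof. by rewrite quadform1_sum sumr_ge0 // => i _; exact: sqr_ge0. Qed.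

Lemma quadform1_gt0 m (v : 'cV[R]_m) : v != 0 -> 0 < quadform 1%:M v.
Proof.
move=> v0; rewrite lt_def quadform1_ge0 andbT; apply: contraNneq v0 => h.
apply/eqP/matrixP => i j; rewrite (ord1 j) mxE.
move: h; rewrite quadform1_sum => /eqP.
rewrite psumr_eq0 => [/allP /(_ i)|k _]; last exact: sqr_ge0.
by rewrite mem_index_enum sqrf_eq0 => /(_ isT) /eqP.
Qed.

Lemma quadform_bounded m (G : 'M[R]_m) :
  exists2 K, 0 < K & forall v, quadform G v <= K * quadform 1%:M v.
Proof.
exists (1 + \sum_i \sum_j `|G j i|).
  by rewrite ltr_pwDl // sumr_ge0 // => i _; rewrite sumr_ge0.
move=> v; have q0 := quadform1_ge0 v.
rewrite mulrDl mul1r -[leLHS]add0r lerD // quadformE /bform mxE mulr_suml.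
apply: ler_sum => i _; rewrite mxE !mulr_suml; apply: ler_sum => j _.
have -> : v^T ord0 j * G j i * v i ord0 = G j i * (v j ord0 * v i ord0).
  by rewrite mxE; ring.
apply: le_trans (ler_norm _) _; rewrite normrM ler_wpM2l // ler_norml.
have hk k : v k ord0 ^+ 2 <= quadform 1%:M v.
  rewrite quadform1_sum (bigD1 k) //= lerDl sumr_ge0 // => l _.
  exact: sqr_ge0.
have := hk i; have := hk j; have := sqr_ge0 (v i ord0 + v j ord0).
have := sqr_ge0 (v i ord0 - v j ord0) => h1 h2 h3 h4.
by apply/andP; split; nra.
Qed.

(** Cauchy-Schwarz for [H] between [H^-1 v] and [v] gives
    |v|^4 <= <H^-1 v, v> <H v, v>, and the form of [H^-1] is bounded by a
    multiple of |v|^2. *)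
Lemma psd_unit_coercive m (H : 'M[R]_m) : spsd H -> H \in unitmx ->
  exists2 K, 0 < K & forall v, quadform 1%:M v <= K * quadform H v.
Proof.
move=> pH uH.
have [K K0 hK] := quadform_bounded (invmx H).
exists K => // v; have [-> | v0] := eqVneq v 0.
  by rewrite !quadform0 mulr0.
have q0 := quadform1_gt0 v0.
have := psd_CauchySchwarz (invmx H *m v) v pH.
have -> : bform H (invmx H *m v) v = quadform 1%:M v.
  rewrite quadformE /bform trmx_mul trmx_inv (proj1 pH) mulmx1.
  by rewrite mulmxKV.
rewrite quadform_mul trmx_inv (proj1 pH) mulVmx // mul1mx => h.
have := proj2 pH v; have := hK v => h1 h2.
have : quadform 1%:M v * quadform 1%:M v
    <= quadform 1%:M v * (K * quadform H v).
  rewrite -expr2; apply: le_trans h _.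
  by rewrite mulrA [_ * K]mulrC ler_wpM2r.
by rewrite ler_pM2l.
Qed.

(** A substitute for the equivalence of norms: it makes the Rayleigh quotients
    bounded below and the operator norms finite. *)
Lemma quadform_rel_bounded m (G A : 'M[R]_m) : spd A ->
  exists2 K, 0 < K & forall v, quadform G v <= K * quadform A v.
Proof.
move=> pA; have [K K0 hK] := quadform_bounded G.
have [K' K'0 hK'] := psd_unit_coercive (spd_spsd pA) (spd_unitmx pA).
exists (K * K') => [|v]; first exact: mulr_gt0.
by rewrite -mulrA; apply: le_trans (hK v) _; rewrite ler_wpM2l // ltW.
Qed.

(** * Rayleigh quotients and eigenvalues *)

(** The extremal case of the spectral theorem for a matrix [B] that is
    self-adjoint in the energy inner product.  Take for [a] the infimum of the
    Rayleigh quotient.  Then [A (B - a)] is positive semidefinite; if [a] were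
    not an eigenvalue, it would be invertible, hence coercive by
    [psd_unit_coercive], and the infimum could be increased. *)
Lemma eigenvalue_rayleigh m (A B : 'M[R]_m) : (0 < m)%N -> spd A ->
  (A *m B)^T = A *m B ->
  exists2 a, eigenvalue B a &
    forall v, a * quadform A v <= quadform (A *m B) v.
Proof.
move=> m0 pA sAB.
pose E : set R :=
  [set quadform (A *m B) v / quadform A v | v in [set v | v != 0]]%classic.
have posA v : v != 0 -> 0 < quadform A v by exact: (proj2 pA).
have lbE : has_lbound E.
  have [K K0 hK] := quadform_rel_bounded (- (A *m B)) pA.
  exists (- K) => _ [v /= v0 <-].
  rewrite ler_pdivlMr ?posA // mulNr lerNl.
  by have := hK v; rewrite -scaleN1r quadformZ mulN1r.
pose a := inf E.
have ale v : a * quadform A v <= quadform (A *m B) v.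
  have [->|v0] := eqVneq v 0; first by rewrite !quadform0 mulr0.
  by rewrite -ler_pdivlMr ?posA //; apply: (ge_inf lbE); exists v.
exists a => //.
have psdH : spsd (A *m B - a *: A).
  split=> [|v]; first by rewrite linearB linearZ /= sAB (proj1 pA).
  by rewrite quadformB quadformZ subr_ge0.
have [//|neig] := boolP (eigenvalue B a).
have uH : A *m B - a *: A \in unitmx.
  have -> : A *m B - a *: A = A *m (B - a%:M).
    by rewrite mulmxBr mul_mx_scalar.
  rewrite unitmx_mul spd_unitmx //= -row_free_unit -kermx_eq0.
  by move: neig; rewrite /eigenvalue /eigenspace negbK.
have [K K0 hK] := psd_unit_coercive psdH uH.
have [K' K'0 hK'] := quadform_bounded A.
have KK : 0 < K' * K by exact: mulr_gt0.
have E0 : (E !=set0)%classic.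
  pose v : 'cV[R]_m := const_mx 1; exists (quadform (A *m B) v / quadform A v).
  exists v => //=; apply/eqP => /matrixP /(_ (Ordinal m0) ord0).
  by rewrite !mxE => /eqP; rewrite oner_eq0.
have [] := @inf_adherent _ E (K' * K)^-1 _ (conj E0 lbE).
  by rewrite invr_gt0.
move=> _ [v /= v0 <-]; rewrite ltr_pdivrMr ?posA // -/a => hlt.
have : quadform A v <= (K' * K) * (quadform (A *m B) v - a * quadform A v).
  apply: le_trans (hK' v) _; rewrite -mulrA; apply: ler_wpM2l; first exact: ltW.
  by have := hK v; rewrite quadformB quadformZ.
rewrite -ler_pdivrMl // lerBrDr; move: hlt; rewrite mulrDl => h1 h2.
by have := lt_le_trans h1; rewrite addrC => /(_ _ h2); rewrite ltxx.
Qed.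

Lemma eigenvalue_lower_bound m (A B : 'M[R]_m) c : spd A ->
  (A *m B)^T = A *m B -> (forall a, eigenvalue B a -> c <= a) ->
  forall v, c * quadform A v <= quadform (A *m B) v.
Proof.
move=> pA sAB hc v; have [->|v0] := eqVneq v 0.
  by rewrite !quadform0 mulr0.
have m0 : (0 < m)%N.
  by rewrite lt0n; apply: contraNneq v0 => m0; apply/eqP/matrixP => -[i hi]; lia.
have [a /hc ca ha] := eigenvalue_rayleigh m0 pA sAB.
by apply: le_trans (ha v); rewrite ler_wpM2r // ltW // (proj2 pA).
Qed.

Lemma sym_pencil m (A S : 'M[R]_m) : A^T = A -> S^T = S ->
  (A *m (invmx S *m A))^T = A *m (invmx S *m A).
Proof. by move=> sA sS; rewrite !trmx_mul trmx_inv sA sS mulmxA. Qed.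

(** The infimum defining [lambda_min] is attained here: by
    [eigenvalue_rayleigh] there is an eigenvalue below all Rayleigh quotients,
    in particular below those of the eigenvectors, which are the eigenvalues.
    [A x = b S x] with [A] and [S] positive definite forces [b > 0]. *)
Lemma lambda_min_pencil m (A S : 'M[R]_m) : (0 < m)%N -> spd A -> spd S ->
  0 < lambda_min (invmx S *m A) /\
  forall v, lambda_min (invmx S *m A) * quadform A v
            <= quadform (A *m (invmx S *m A)) v.
Proof.
move=> m0 pA pS.
have uS := spd_unitmx pS.
have sB := sym_pencil (proj1 pA) (proj1 pS).
(* [eigenvalue] speaks of row eigenvectors [w] of [S^-1 A]; by symmetry of [A]
   and [S], the column [S^-1 w^T] is then a right eigenvector. *)
have right_eig b : eigenvalue (invmx S *m A) b ->
    exists2 x : 'cV[R]_m, x != 0 & A *m x = b *: (S *m x).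
  move=> /eigenvalueP [w hw w0]; exists (invmx S *m w^T).
    apply: contraNneq w0 => /(congr1 (mulmx S)).
    by rewrite mulKVmx // mulmx0 => h; rewrite -[w]trmxK h trmx0.
  rewrite mulKVmx //; apply: trmx_inj; rewrite linearZ /= !trmx_mul trmxK.
  by rewrite trmx_inv (proj1 pA) (proj1 pS) -mulmxA.
have eig_form b x : A *m x = b *: (S *m x) ->
    quadform A x = b * quadform S x /\
    quadform (A *m (invmx S *m A)) x = b * quadform A x.
  move=> hx; split.
    by rewrite /quadform hx linearZ /= -scalemxAl mxE.
  rewrite !quadformE /bform -!mulmxA hx -!scalemxAr mulKmx //.
  by rewrite hx -!scalemxAr !mxE.
have eig_gt0 b : eigenvalue (invmx S *m A) b -> 0 < b.
  move=> /right_eig [x x0 /eig_form [h _]].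
  by have := proj2 pA _ x0; rewrite h pmulr_lgt0 // (proj2 pS).
have [a ea ha] := eigenvalue_rayleigh m0 pA sB.
split.
  apply: lt_le_trans (eig_gt0 _ ea) _; apply: lb_le_inf; first by exists a.
  move=> b /= /right_eig [x x0 /eig_form [_ h]].
  by have := ha x; rewrite h ler_pM2r // (proj2 pA).
apply: eigenvalue_lower_bound => // b eb.
by apply: ge_inf => //; exists 0 => c /= /eig_gt0 /ltW.
Qed.

(** * Operator norms and energy-bounded matrices *)

Lemma energy_norm_sqr m (A : 'M[R]_m) v : spd A ->
  energy_norm A v ^+ 2 = quadform A v.
Proof. by move=> pA; rewrite sqr_sqrtr // (proj2 (spd_spsd pA)). Qed.

Lemma energy_norm_gt0 m (A : 'M[R]_m) v : spd A -> v != 0 ->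
  0 < energy_norm A v.
Proof. by move=> pA v0; rewrite sqrtr_gt0 (proj2 pA). Qed.

(** The supremum in [op_norm] is meaningful only if the quotients are bounded,
    which [quadform_rel_bounded] provides. *)
Lemma energy_norm_mul_le m (A E : 'M[R]_m) v : spd A ->
  energy_norm A (E *m v) <= op_norm A E * energy_norm A v.
Proof.
move=> pA; have [->|v0] := eqVneq v 0.
  by rewrite mulmx0 /energy_norm quadform0 sqrtr0 mulr0.
rewrite -ler_pdivrMr ?energy_norm_gt0 //; apply: ub_le_sup; last by exists v.
have [K K0 hK] := quadform_rel_bounded (E^T *m A *m E) pA.
exists (Num.sqrt K) => _ [w /= w0 <-].
rewrite ler_pdivrMr ?energy_norm_gt0 // /energy_norm -sqrtrM ?(ltW K0) //.
by rewrite ler_wsqrtr // quadform_mul.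
Qed.

Lemma quadform_le_op_norm m (A E : 'M[R]_m) v : spd A ->
  quadform (A *m E) v <= op_norm A E * quadform A v.
Proof.
move=> pA; have := psd_CauchySchwarz v (E *m v) (spd_spsd pA).
rewrite bform_mulr -quadformE -(energy_norm_sqr v pA).
rewrite -(energy_norm_sqr (E *m v) pA) -exprMn => h.
apply: le_trans (ler_norm _) _.
have e0 u : 0 <= energy_norm A u by exact: sqrtr_ge0.
have : `|quadform (A *m E) v| <= energy_norm A v * energy_norm A (E *m v).
  by rewrite -(@ler_pXn2r _ 2) ?nnegrE ?mulr_ge0 // real_normK ?num_real.
move=> /le_trans; apply; rewrite expr2 mulrCA ler_wpM2l //.
exact: energy_norm_mul_le.
Qed.

(** The matrix [E] is self-adjoint in the energy inner product, with spectrum in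
    [[0, c]].  The bound is put on the form and not on the norm because the form
    of a cycle is an affine function of the form of its coarse solver. *)
Definition energy_bounded m (A E : 'M[R]_m) c :=
  (A *m E)^T = A *m E /\
  forall v, 0 <= quadform (A *m E) v <= c * quadform A v.

(** Cauchy-Schwarz for the semidefinite form of [A E], applied to [v] and [E v]:
    the left-hand side squared is at most <AEv, v> <AE(Ev), Ev>, which is at most
    c^2 <Av, v> times the left-hand side itself. *)
Lemma energy_bounded_mul m (A E : 'M[R]_m) c v : 0 <= c -> spd A ->
  energy_bounded A E c -> quadform A (E *m v) <= c ^+ 2 * quadform A v.
Proof.
move=> c0 pA [sE bE].
have pE : spsd (A *m E) by split=> // u; case/andP: (bE u).
have q0 u := proj2 (spd_spsd pA) u.
have := psd_CauchySchwarz v (E *m v) pE.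
have -> : bform (A *m E) v (E *m v) = quadform A (E *m v).
  rewrite quadformE /bform trmx_mul !mulmxA -(mulmxA v^T A) -sE trmx_mul.
  by rewrite (proj1 pA) !mulmxA.
have /andP[h1 h2] := bE v; have /andP[h3 h4] := bE (E *m v) => h.
have [-> | ne] := eqVneq (quadform A (E *m v)) 0.
  by rewrite mulr_ge0 // sqr_ge0.
have qp : 0 < quadform A (E *m v) by rewrite lt_def ne q0.
rewrite -(ler_pM2r qp) -expr2; apply: le_trans h _.
apply: le_trans (ler_pM h1 h3 h2 h4) _.
by rewrite le_eqVlt; apply/orP; left; apply/eqP; ring.
Qed.

Lemma energy_bounded_op_norm m (A E : 'M[R]_m) c : 0 <= c -> spd A ->
  energy_bounded A E c -> op_norm A E <= c.
Proof.
move=> c0 pA bE.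
rewrite /op_norm; set F := (X in sup X).
have [->|/set0P ne] := eqVneq F set0%classic; first by rewrite sup0.
apply: ge_sup => // _ [v /= v0 <-].
rewrite ler_pdivrMr ?energy_norm_gt0 //.
rewrite -(@ler_pXn2r _ 2) ?nnegrE ?sqrtr_ge0 ?mulr_ge0 ?sqrtr_ge0 //.
by rewrite exprMn !energy_norm_sqr //; exact: energy_bounded_mul.
Qed.

(** Induction in steps of two: <A E^(k+2) v, v> = <A E^k (E v), E v>, and the
    energy of [E v] is controlled by [energy_bounded_mul]. *)
Lemma energy_bounded_exp m (A E : 'M[R]_m) c k : 0 <= c -> spd A ->
  energy_bounded A E c -> energy_bounded A (E ^+ k) (c ^+ k).
Proof.
move=> c0 pA bE.
have q0 u := proj2 (spd_spsd pA) u.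
have [n] := ubnP k; elim: n k => // n IHn [|[|k]] hk.
- rewrite expr0 -idmxE /energy_bounded mulmx1.
  by split=> [|v]; rewrite ?(proj1 pA) // expr0 mul1r q0 lexx.
- by rewrite !expr1.
have [sk bk] := IHn k (ltnW hk).
have eqE : A *m E ^+ k.+2 = E^T *m (A *m E ^+ k) *m E.
  rewrite exprSr exprS -!mulmxE !mulmxA; congr (_ *m _ *m _).
  by rewrite -(proj1 bE) trmx_mul (proj1 pA).
split=> [|v]; first by rewrite eqE 2!trmx_mul trmxK sk mulmxA.
rewrite eqE -quadform_mul; have /andP[-> h] := bk (E *m v).
apply: le_trans h _; rewrite -[k.+2]addn2 exprD -mulrA.
by rewrite ler_wpM2l ?exprn_ge0 //; apply: energy_bounded_mul.
Qed.

(** * Smoothers *)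

(** [Mt] describes the smoothing step with [M^T]: the product of the presmoother
    and the postsmoother, in this order, is [1 - Mt^-1 A].  The energy of the
    postsmoothed vector is therefore the energy minus the form of
    [A Mt^-1 A]. *)
Lemma symmetrized_smoother m (A M : 'M[R]_m) (N := M + M^T - A)
    (Mt := M^T *m invmx N *m M) :
  M \in unitmx -> spd A -> spd N ->
  spd Mt /\
  (1%:M - invmx M^T *m A)^T *m A *m (1%:M - invmx M^T *m A)
  = A - A *m (invmx Mt *m A).
Proof.
move=> uM pA pN; have uN := spd_unitmx pN.
have uMT : M^T \in unitmx by rewrite unitmx_tr.
have pNi v : v != 0 -> 0 < quadform (invmx N) v.
  move=> v0; rewrite -[v](mulKVmx uN) quadform_mul (proj1 pN) mulmxV // mul1mx.
  apply: (proj2 pN); apply: contraNneq v0 => h.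
  by rewrite -[v](mulKVmx uN) h mulmx0.
split; first split.
- by rewrite !trmx_mul trmxK trmx_inv (proj1 pN) mulmxA.
- move=> v v0; rewrite /Mt -quadform_mul; apply: pNi.
  by apply: contraNneq v0 => h; rewrite -[v](mulKmx uM) h mulmx0.
have Mt1 : Mt *m (invmx M *m N *m invmx M^T) = 1%:M.
  by rewrite /Mt !mulmxA mulmxK // mulmxKV // mulmxV.
have [uMt _] := mulmx1_unit Mt1.
have -> : invmx Mt = invmx M *m N *m invmx M^T.
  by rewrite -[RHS](mulKmx uMt) Mt1 mulmx1.
rewrite [(1%:M - _)^T]linearB /= trmx1 trmx_mul trmx_inv trmxK (proj1 pA) /N.
rewrite !(mulmxBl, mulmxBr, mulmxDl, mulmxDr) !(mul1mx, mulmx1).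
rewrite -!mulmxA mulKmx // mulKVmx //.
rewrite !(mulmxN, mulNmx, opprK, opprD) -!mulmxA.
by rewrite !addrA; congr (_ + _); rewrite addrAC.
Qed.

(** The eigenvalue bound controls the postsmoother [T'].  It passes to the
    presmoother [T] since an operator and its adjoint have the same energy norm:
    <ATv, Tv> = <Av, T'Tv>, and Cauchy-Schwarz applies. *)
Lemma smoother_contraction m (A M : 'M[R]_m) (N := M + M^T - A)
    (Mt := M^T *m invmx N *m M) eps :
  M \in unitmx -> spd A -> spd N -> 0 <= 1 - eps ->
  (forall v, eps * quadform A v <= quadform (A *m (invmx Mt *m A)) v) ->
  forall v, quadform A ((1%:M - invmx M *m A) *m v) <= (1 - eps) * quadform A v.
Proof.
move=> uM pA pN e1 heps v.
have [_ eqT] := symmetrized_smoother uM pA pN.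
set T := 1%:M - invmx M *m A; set T' := 1%:M - invmx M^T *m A in eqT.
have adj : A *m T' = T^T *m A.
  rewrite mulmxBr mulmx1 [T^T]linearB /= trmx1 mulmxBl mul1mx trmx_mul.
  by rewrite trmx_inv (proj1 pA) mulmxA.
have hT' u : quadform A (T' *m u) <= (1 - eps) * quadform A u.
  by rewrite quadform_mul eqT quadformB mulrBl mul1r lerB ?heps.
have q0 u := proj2 (spd_spsd pA) u.
have := psd_CauchySchwarz v (T' *m (T *m v)) (spd_spsd pA).
rewrite bform_mulr adj.
have -> : bform (T^T *m A) v (T *m v) = quadform A (T *m v).
  by rewrite quadformE /bform trmx_mul !mulmxA.
move=> h; have [-> | ne] := eqVneq (quadform A (T *m v)) 0.
  exact: mulr_ge0.
have qp : 0 < quadform A (T *m v) by rewrite lt_def ne q0.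
rewrite -(ler_pM2r qp) -expr2; apply: le_trans h _.
by rewrite [_ * quadform A v]mulrC -mulrA ler_wpM2l.
Qed.

(** * One multigrid cycle *)

(** The number [delta] measures the inexactness of the coarse solver [S], with
    [delta = 0] for [S = Ac^-1].  The form of the cycle is affine and decreasing
    in that of [S], so it is at most the combination with weights [1 - delta]
    and [delta] of the forms for [S = Ac^-1] (two-grid) and [S = 0]
    (smoothing only). *)
Lemma cycle_energy_bounded m p (A T T' : 'M[R]_m) (P : 'M[R]_(m, p))
    (Ac S : 'M[R]_p) sigma eps delta :
  Ac = P^T *m A *m P -> spd A -> spd Ac -> A *m T' = T^T *m A ->
  S^T = S -> 0 <= delta <= 1 ->
  (forall w, (1 - delta) * quadform Ac w <= quadform S (Ac *m w)
             <= quadform Ac w) ->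
  (forall v, quadform (A *m (T' *m (1%:M - P *m invmx Ac *m P^T *m A) *m T)) v
             <= sigma * quadform A v) ->
  (forall v, quadform A (T *m v) <= (1 - eps) * quadform A v) ->
  energy_bounded A (T' *m (1%:M - P *m S *m P^T *m A) *m T)
    ((1 - delta) * sigma + delta * (1 - eps)).
Proof.
move=> eAc pA pAc adj sS /andP[d0 d1] hS hTG hT.
have sA := proj1 pA.
have factor X : A *m (T' *m (1%:M - P *m X *m P^T *m A) *m T)
    = T^T *m (A - (P^T *m A)^T *m X *m (P^T *m A)) *m T.
  rewrite trmx_mul trmxK sA !mulmxA adj mulmxBr mulmx1 mulmxBr.
  by rewrite !mulmxA.
have eqQ X v (u := T *m v) (w := invmx Ac *m (P^T *m A *m u)) :
    quadform (A *m (T' *m (1%:M - P *m X *m P^T *m A) *m T)) v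
    = quadform A u - quadform X (Ac *m w).
  rewrite factor -quadform_mul quadformB /w mulKVmx ?spd_unitmx //.
  by rewrite [quadform X _]quadform_mul.
(* [P w] is the energy projection of [u], so <Ac w, w> is the energy of the
   projection. *)
have proj_le u (w := invmx Ac *m (P^T *m A *m u)) :
    quadform Ac w <= quadform A u.
  have hw : Ac *m w = P^T *m A *m u by rewrite /w mulKVmx ?spd_unitmx.
  have := proj2 (spd_spsd pA) (1 *: u + (-1) *: (P *m w)).
  rewrite quadform_comb // [quadform A (P *m w)]quadform_mul -eAc.
  have -> : bform A u (P *m w) = quadform Ac w.
    rewrite -bform_tr sA quadformE /bform trmx_mul -!mulmxA (mulmxA P^T A u).
    by rewrite -hw !mulmxA.
  lra.
split.
  rewrite factor !trmx_mul !trmxK [(A - _)^T]linearB /= !trmx_mul !trmxK sA sS.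
  by rewrite !mulmxA.
move=> v; rewrite eqQ; set u := T *m v; set w := invmx Ac *m _.
have /andP[lo hi] := hS w; have := proj_le u; rewrite -/w => pr.
apply/andP; split; first by rewrite subr_ge0; apply: le_trans hi pr.
have := hTG v; rewrite eqQ -/u -/w.
rewrite [quadform (invmx Ac) _]quadform_mul (proj1 pAc).
rewrite mulmxV ?spd_unitmx // mul1mx => tg; have := hT v; rewrite -/u => tv.
have := ler_wpM2l d0 tv; have : 0 <= 1 - delta by rewrite subr_ge0.
move=> /ler_wpM2l /(_ _ _ tg).
move: lo; move: (quadform A u) (quadform A v) (quadform Ac w) (quadform S _).
move=> a b c d; lra.
Qed.

(** With [E] the error matrix of an iteration with zero initial guess for a
    system with matrix [A], the approximate inverse is (1 - E) A^-1, and its form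
    at [A w] is <Aw, w> - <AEw, w>. *)
Lemma energy_bounded_coarse m (A E : 'M[R]_m) c : spd A -> 0 <= c ->
  energy_bounded A E c ->
  ((1%:M - E) *m invmx A)^T = (1%:M - E) *m invmx A /\
  forall w, (1 - c) * quadform A w
    <= quadform ((1%:M - E) *m invmx A) (A *m w) <= quadform A w.
Proof.
move=> pA c0 [sE bE]; have uA := spd_unitmx pA; split.
  rewrite trmx_mul trmx_inv (proj1 pA) linearB /= trmx1.
  have -> : E^T = A *m E *m invmx A.
    by rewrite -sE trmx_mul (proj1 pA) mulmxK.
  by rewrite mulmxBr mulmxBl mulmx1 mul1mx -!mulmxA mulKmx.
move=> w.
have -> : quadform ((1%:M - E) *m invmx A) (A *m w)
    = quadform A w - quadform (A *m E) w.
  rewrite quadform_mul (proj1 pA) -!mulmxA mulVmx // mulmx1.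
  by rewrite mulmxBr mulmx1 quadformB.
by have /andP[h1 h2] := bE w; rewrite gerBl h1 andbT mulrBl mul1r lerB.
Qed.

(** The lower bound is the eigenvalue bound for [S^-1 A].  For the upper bound,
    put [y = S^-1 A w]: the form of [S^-1] at [A w] is q = <Sy, y> = <Ay, w>, and
    0 <= <A (y - w), y - w> <= q - 2 q + <Aw, w> since [A <= S]. *)
Lemma coarsest_bounds m (A S : 'M[R]_m) c : spd A -> spd S -> spsd (S - A) ->
  (forall a, eigenvalue (invmx S *m A) a -> c <= a) ->
  forall w, c * quadform A w <= quadform (invmx S) (A *m w) <= quadform A w.
Proof.
move=> pA pS pSA hc w; have sA := proj1 pA; have uS := spd_unitmx pS.
have sB := sym_pencil sA (proj1 pS).
rewrite {1}quadform_mul sA -(mulmxA A).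
apply/andP; split; first exact: eigenvalue_lower_bound.
set y := invmx S *m (A *m w).
have hy : S *m y = A *m w by rewrite mulKVmx.
have -> : quadform (invmx S) (A *m w) = quadform S y.
  by rewrite -hy quadform_mul (proj1 pS) mulmxV // mul1mx.
have := proj2 (spd_spsd pA) (1 *: y + (-1) *: w); have := proj2 pSA y.
rewrite quadform_comb // quadformB.
have -> : bform A y w = quadform S y.
  by rewrite quadformE /bform -!mulmxA -hy.
lra.
Qed.

Lemma galerkin_spd m p (A : 'M[R]_m) (P : 'M[R]_(m, p)) :
  \rank P = p -> spd A -> spd (P^T *m A *m P).
Proof.
move=> rP pA; split; first by rewrite !trmx_mul trmxK (proj1 pA) mulmxA.
move=> v v0; rewrite -quadform_mul; apply: (proj2 pA).
apply: contraNneq v0 => /(congr1 trmx) /eqP.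
rewrite trmx_mul trmx0 mulmx_free_eq0 ?trmx_eq0 //.
by rewrite /row_free mxrank_tr rP.
Qed.

End Forms.

(** * The scalar equation *)

Section ScalarEquation.
Variables (R : realType) (sigma eps : R) (gamma : nat).
Hypotheses (s0 : 0 < sigma) (s1 : sigma < 1 - eps) (e0 : 0 < eps).
Hypothesis (gamma1 : (1 <= gamma)%N).

Let is_root x := 0 < x < 1 /\ (1 - sigma - eps) * x ^+ gamma - x + sigma = 0.

(** With c = 1 - sigma - eps > 0, a root satisfies x - sigma = c x ^ gamma; the
    right-hand side is positive and, since x ^ gamma <= x, at most c x. *)
Lemma cycle_root_interval x : is_root x -> sigma < x <= sigma / (sigma + eps).
Proof.
move=> [/andP[x0 x1] hx]; have c0 : 0 < 1 - sigma - eps by have := s1; lra.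
have xg0 : 0 < x ^+ gamma by rewrite exprn_gt0.
have cx0 := mulr_gt0 c0 xg0.
have xg : x ^+ gamma <= x.
  by rewrite -[leRHS]expr1; apply: ler_wiXn2l => //; exact: ltW.
have := ler_wpM2l (ltW c0) xg => h.
apply/andP; split; first lra.
by rewrite ler_pdivlMr ?addr_gt0 //; lra.
Qed.

(** The polynomial x - c x ^ gamma - sigma, with c = 1 - sigma - eps, is negative
    at [sigma] and equals eps > 0 at 1. *)
Lemma cycle_root_exists : exists x, is_root x.
Proof.
have c0 : 0 < 1 - sigma - eps by have := s1; lra.
pose p : {poly R} := 'X - (1 - sigma - eps) *: 'X^gamma - sigma%:P.
have pE x : p.[x] = x - (1 - sigma - eps) * x ^+ gamma - sigma.
  by rewrite /p !hornerE.
have p1 : p.[1] = eps by rewrite pE expr1n; ring.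
have sg0 : 0 < sigma ^+ gamma by rewrite exprn_gt0.
have [||x /andP[sx x1] /eqP] := @poly_ivt R p sigma 1.
- by have := s1; have := e0; lra.
- by rewrite p1 pE (ltW e0) andbT; have := mulr_gt0 c0 sg0; lra.
rewrite pE => hx; exists x; split; last lra.
rewrite (lt_le_trans s0 sx) lt_neqAle x1 andbT /=.
by apply/eqP => x1'; move: hx; rewrite -pE x1' p1; have := e0; lra.
Qed.

(** At [1] the polynomial of the equation equals [- eps]; this is what remains
    after the factor [1 - x] has been split off the difference. *)
Lemma cycle_root_factor x : (1 - sigma - eps) * x ^+ gamma - x + sigma = 0 ->
  (1 - x) * (1 - (1 - sigma - eps) * \sum_(i < gamma) x ^+ i) = eps.
Proof.
move=> hx; have := subrX1 x gamma.
set S := \sum_(i < gamma) _ => hS.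
have -> : (1 - x) * (1 - (1 - sigma - eps) * S)
  = 1 - x + (1 - sigma - eps) * ((x - 1) * S) by ring.
by rewrite -hS; lra.
Qed.

(** Both factors in [cycle_root_factor] decrease in [x], the first one strictly;
    at the larger root the second one is positive because [eps] is, so the
    products cannot agree. *)
Lemma cycle_root_unique x y : is_root x -> is_root y -> x = y.
Proof.
wlog lt_xy : x y / x < y.
  move=> wl hx hy; have [xy|yx|//] := ltgtP x y; first exact: wl.
  by symmetry; apply: wl.
move=> [/andP[x0 x1] /cycle_root_factor fx] [/andP[y0 y1] /cycle_root_factor fy].
move: fx fy; set Sx := \sum_(i < gamma) x ^+ i; set Sy := \sum_(i < gamma) y ^+ i.
have Sxy : Sx <= Sy.
  by apply: ler_sum => i _; rewrite lerXn2r ?nnegrE ?ltW.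
have c0 : 0 < 1 - sigma - eps by have := s1; lra.
have := ler_wpM2l (ltW c0) Sxy.
set a := _ * Sx; set b := _ * Sy => ab fx fy.
have b1 : 0 < 1 - b.
  by rewrite -(pmulr_rgt0 _ (_ : 0 < 1 - y)) ?subr_gt0 // fy.
have : (1 - y) * (1 - b) < (1 - x) * (1 - b) by rewrite ltr_pM2r //; lra.
have : (1 - x) * (1 - b) <= (1 - x) * (1 - a) by rewrite ler_pM2l; lra.
lra.
Qed.

End ScalarEquation.

(** * The recursion over the levels *)

Section LevelExtrema.
Variables (R : realType) (L : nat) (f : nat -> R).

Lemma level_le_max k : (1 <= k <= L)%N ->
  f k <= \big[Num.max/f 1%N]_(1 <= j < L.+1) f j.
Proof. by move=> hk; apply: le_bigmax_seq; rewrite // mem_index_iota ltnS. Qed.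

Lemma level_min_le k : (1 <= k <= L)%N ->
  \big[Num.min/f 1%N]_(1 <= j < L.+1) f j <= f k.
Proof.
by move=> hk; apply: (@bigmin_inf_seq _ _ _ _ _ k);
   rewrite // mem_index_iota ltnS.
Qed.

Lemma level_min_gt c : (1 <= L)%N -> (forall k, (1 <= k <= L)%N -> c < f k) ->
  c < \big[Num.min/f 1%N]_(1 <= j < L.+1) f j.
Proof.
move=> hL hf; rewrite big_seq; apply: (big_ind (fun y => c < y))
  => [|x y cx cy|k].
- by apply: hf; rewrite hL.
- by rewrite lt_min cx.
- by rewrite mem_index_iota ltnS => /hf.
Qed.

End LevelExtrema.

Theorem theorem4p4 (R : realType) (L : nat) (n : nat -> nat)
  (A : forall k : nat, 'M[R]_(n k)) (P : forall k : nat, 'M[R]_(n k, n k.-1))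
  (M : forall k : nat, 'M[R]_(n k)) (hatA0 : 'M[R]_(n 0%N)) (gamma : nat)
  (hL : (1 <= L)%N)
  (hn : forall k : nat, (1 <= k <= L)%N -> (n k.-1 < n k)%N)
  (hA : spd (A L))
  (hP : forall k : nat, (1 <= k <= L)%N -> \rank (P k) = n k.-1)
  (hGalerkin : forall k : nat, (1 <= k <= L)%N ->
     A k.-1 = (P k)^T *m A k *m P k)
  (hhatA0 : spd hatA0)
  (hhatA0_A0 : spsd (hatA0 - A 0%N))
  (hM : forall k : nat, (1 <= k <= L)%N -> M k \in unitmx)
  (hMA : forall k : nat, (1 <= k <= L)%N -> spd (M k + (M k)^T - A k))
  (hgamma : (1 <= gamma)%N) :
  let sigma := sigma_max A P M L in
  let eps := eps_min A M L in
  let is_root := fun x : R =>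
    0 < x < 1 /\ (1 - sigma - eps) * x ^+ gamma - x + sigma = 0 in
  0 < sigma < 1 - eps ->
  (exists! x : R, is_root x) /\
  (forall x : R, is_root x ->
     sigma < x <= sigma / (sigma + eps) /\
     ((forall a : R, eigenvalue (invmx hatA0 *m A 0%N) a ->
         (1 - eps - x) / (1 - eps - sigma) <= a <= 1) ->
      forall k : nat, (1 <= k <= L)%N -> sigma_IMG A P M hatA0 gamma k <= x)).
Proof.
move=> sigma eps is_root /andP[s0 s1].
have pA k : (k <= L)%N -> spd (A k).
  move=> kL; rewrite -(subKn kL); move: (L - k)%N (leq_subr k L).
  elim=> [|j IHj] jL; first by rewrite subn0.
  have hk : (1 <= L - j <= L)%N by lia.
  rewrite subnS hGalerkin //; apply: galerkin_spd; first exact: hP.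
  by apply: IHj; lia.
have n0 k : (1 <= k <= L)%N -> (0 < n k)%N by move=> /hn; lia.
have lam k (hk : (1 <= k <= L)%N) :
    0 < lambda_min (invmx (Mtilde A M k) *m A k) /\
    forall v, eps * quadform (A k) v
      <= quadform (A k *m (invmx (Mtilde A M k) *m A k)) v.
  have pAk : spd (A k) by apply: pA; lia.
  have [pMt _] := symmetrized_smoother (hM k hk) pAk (hMA k hk).
  have [l0 hl] := lambda_min_pencil (n0 k hk) pAk pMt.
  split=> // v; apply: le_trans (hl v).
  by rewrite ler_wpM2r ?(proj2 (spd_spsd pAk)) // level_min_le.
have e0 : 0 < eps by apply: level_min_gt => // k /lam [].
split.
  have [x hx] := cycle_root_exists gamma s0 s1 e0.
  exists x; split=> // y hy.
  exact: (cycle_root_unique s1 e0 hx hy).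
move=> x hx; have hint := cycle_root_interval s0 s1 e0 hgamma hx.
split=> // heig.
have [/andP[x0 x1] xeq] := hx.
have d01 : 0 <= x ^+ gamma <= 1 by rewrite exprn_ge0 ?exprn_ile1 ?ltW.
(* The equation for [x] says that the constant of [cycle_energy_bounded] with
   [delta = x ^+ gamma] reproduces [x]. *)
have fixpoint : (1 - x ^+ gamma) * sigma + x ^+ gamma * (1 - eps) = x by lra.
have coarsest : (1 - eps - x) / (1 - eps - sigma) = 1 - x ^+ gamma.
  by apply: canLR (mulfK _) _; [rewrite subr_eq0; lra | lra].
have step i (E := E_IMG A P M hatA0 gamma i)
    (S := coarse_solve A hatA0 gamma E) : (i < L)%N ->
    S^T = S /\ (forall w, (1 - x ^+ gamma) * quadform (A i) w
      <= quadform S (A i *m w) <= quadform (A i) w) ->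
    energy_bounded (A i.+1) (E_IMG A P M hatA0 gamma i.+1) x.
  move=> iL [sS hS]; have hk : (1 <= i.+1 <= L)%N by [].
  have pAk := pA _ iL; have [_ hl] := lam _ hk.
  rewrite -{1}fixpoint /=.
  apply: (cycle_energy_bounded (hGalerkin _ hk) pAk (pA _ (ltnW iL)) _ sS d01 hS).
  - rewrite /postsmooth /presmooth mulmxBr mulmx1 linearB /= trmx1 mulmxBl.
    by rewrite mul1mx trmx_mul (proj1 pAk) !mulmxA.
  - move=> v; apply: le_trans (quadform_le_op_norm (E_TG A P M i.+1) v pAk) _.
    rewrite ler_wpM2r ?(proj2 (spd_spsd pAk)) //.
    exact: (@level_le_max _ L (sigma_TG A P M)).
  - by apply: (smoother_contraction (hM _ hk) pAk (hMA _ hk)) => //; lra.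
have bounded i : (i < L)%N ->
    energy_bounded (A i.+1) (E_IMG A P M hatA0 gamma i.+1) x.
  elim: i => [|i IHi] iL; apply: step => //.
    split; first by rewrite /= trmx_inv (proj1 hhatA0).
    apply: coarsest_bounds => //; first exact: pA.
    by move=> a /heig; rewrite coarsest => /andP[].
  have pAi := pA _ (ltnW iL).
  apply: energy_bounded_coarse => //; first by rewrite exprn_ge0 // ltW.
  by apply: energy_bounded_exp => //; [exact: ltW | apply: IHi; exact: ltnW].
case=> // k kL.
by apply: energy_bounded_op_norm; [exact: ltW | exact: pA | exact: bounded].
Qed.
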